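(* Consider the multi-agent game with uncertain constraints described in the context, with $M$ agents, decision vector $x=(x^m)_{m=1}^M\in\mathbb{R}^{dM}$, and suppose that assumptions (1)–(3) of the context hold. Let $N\ge1$, fix $\beta\in(0,1)$ and let $\epsilon:\{0,\dots,N\}\to[0,1]$ be a function such that $$\epsilon(N)=1\quad\text{and}\quad \sum_{k=0}^{N-1}\binom{N}{k}(1-\epsilon(k))^{N-k}=\beta .$$ Then $$\mathbb{P}^N\Big\{\{\delta_i\}_{i=1}^N\in\Delta^N:\ \text{there exists a Nash equilibrium } x_{NE}\text{ of the scenario game with } V(x_{NE})>\epsilon(F_N)\Big\}\le\beta,$$ where $\mathbb{P}^N=\prod_{i=1}^N\mathbb{P}$ and $F_N$ is the number of facets of $\Pi_N$.
   Context: Setting. $(\Delta,\mathcal{F},\mathbb{P})$ is a probability space whose elements are vectors $\delta=(a^T\ b)\in\mathbb{R}^{dM+1}$ with $a\in\mathbb{R}^{dM}$, $b\in\mathbb{R}$. A multisample $\{\delta_i\}_{i=1}^N\in\Delta^N$ consists of $N$ independent samples drawn from $\mathbb{P}$. All sets whose probability is written are understood to be measurable. Agents are indexed by $m\in\mathcal{M}=\{1,\dots,M\}$; agent $m$ has decision vector $x^m\in X^m\subseteq\mathbb{R}^d$ and cost function $J_m: X\to\mathbb{R}$, where $X=\prod_{m=1}^M X^m\subset\mathbb{R}^{dM}$. We write $x=(x^m,x^{-m})$, with $x^{-m}$ the decisions of all agents other than $m$. Assumptions. (1) $X$ is a non-empty, compact, convex polytope. (2) For each $\delta=(a^T\ b)\in\Delta$,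 $X_\delta=\{x\in\mathbb{R}^{dM}: g(x,\delta)\le0\}$, where $g(x,\delta)=a^Tx-b$. Given the others' decisions $x^{-m}$, agent $m$'s uncertain constraint set is $X^m_\delta=\{x^m\in X^m: g(x^m,x^{-m},\delta)\le0\}$. (3) For each multisample $\{\delta_i\}_{i=1}^N\in\Delta^N$, the polytope $\Pi_N=\big(\bigcap_{i=1}^N X_{\delta_i}\big)\cap X$ has non-empty interior. Scenario game. Given $\{\delta_i\}_{i=1}^N$, each agent $m$ solves, given $x^{-m}$, $\min_{x^m\in X^m}J_m(x^m,x^{-m})$ subject to $x^m\in\bigcap_{i=1}^N X^m_{\delta_i}$. A Nash equilibrium of the scenario game is a feasible vector $x_{NE}=(x_{NE}^m)_{m\in\mathcal{M}}\in\Pi_N$ such that, for every $m\in\mathcal{M}$, $J_m(x_{NE}^m,x_{NE}^{-m})\le J_m(x^m,x_{NE}^{-m})$ for every $x^m\in\bigcap_{i=1}^N X^m_{\delta_i}$ (these sets being evaluated at $x^{-m}=x^{-m}_{NE}$). Probability of violation of a point: $V(x)=\mathbb{P}\{\delta\in\Delta: x\notin X_\delta\}$. A facet of a polytope $\Pi$ is a face of dimension $\dim(\Pi)-1$. Convention: $\epsilon(k)=1$ for $k>N$. *)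

(* Defs.v *)
From HB Require Import structures.
From mathcomp Require Import all_boot all_order all_algebra.
From mathcomp Require Import finmap.
From mathcomp Require Import all_classical all_reals all_analysis.

Set Implicit Arguments.
Unset Strict Implicit.
Unset Printing Implicit Defensive.

Import Order.TTheory GRing.Theory Num.Theory numFieldNormedType.Exports.

Local Open Scope classical_set_scope.
Local Open Scope ring_scope.

(* The N-fold product of a probability P, on N.-tuple T with the sigma-algebra
   generated by the coordinate projections. power_prob_box below shows that it
   gives measurable boxes the product of the probabilities of their sides. *)
Section power_probability.
Context {d : measure_display} {T : measurableType d} {R : realType}.

Definition cons_pair n (p : T * n.-tuple T) : n.+1.-tuple T :=
  [tuple of p.1 :: p.2].

Lemma measurable_cons_pair n : measurable_fun setT (@cons_pair n).
Proof. by apply: measurable_cons. Qed.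

HB.instance Definition _ n :=
  isMeasurableFun.Build _ _ _ _ (@cons_pair n) (@measurable_cons_pair n).

Fixpoint power_prob (P : probability T R) (n : nat) :
    probability (n.-tuple T) R :=
  match n with
  | 0 => \d_([tuple] : 0.-tuple T)
  | n'.+1 => distribution (P \x power_prob P n')%E (@cons_pair n')
  end.

Lemma power_prob_box (P : probability T R) n (A : 'I_n -> set T) :
    (forall i, measurable (A i)) ->
  power_prob P n [set w | forall i, A i (tnth w i)] = (\prod_(i < n) P (A i))%E.
Proof.
elim: n A => [|n IHn] A mA /=.
  by rewrite big_ord0 diracE mem_set//= => -[].
have mB : measurable [set w : n.-tuple T | forall i, A (lift ord0 i) (tnth w i)].
  rewrite [X in measurable X](_ : _ = \bigcap_(i in [set: 'I_n])
      ((fun w : n.-tuple T => tnth w i) @^-1` A (lift ord0 i))).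
    apply: fin_bigcap_measurable => //= i _; rewrite -[X in measurable X]setTI.
    exact: (measurable_tnth i).
  by apply/seteqP; split => w /= Aw i; [move=> _; exact: Aw | exact: (Aw i I)].
rewrite big_ord_recl -IHn// -product_measure1E//.
congr (product_measure1 _ _ _); apply/seteqP; split => -[x w] /= Axw.
  split=> [|i]; first exact: (Axw ord0).
  by have := Axw (lift ord0 i); rewrite /cons_pair/= tnthS.
move=> i; case: (unliftP ord0 i) => [j ->|->]; last exact: Axw.1.
by rewrite /cons_pair/= tnthS; exact: Axw.2.
Qed.

End power_probability.

(* Vectors of R^(dM) are M x d matrices: row m of x is the decision of agent m. *)
Section polytopes.
Context {R : realType} {M d : nat}.
Implicit Types (S F Pi : set 'M[R]_(M, d)) (W : {vspace 'M[R]_(M, d)}).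

Definition dotmx (u v : 'M[R]_(M, d)) : R := \sum_m \sum_j u m j * v m j.

(* A polytope is a compact polyhedron; its convexity is then automatic. *)
Definition polyhedron S : Prop :=
  exists k (c : 'I_k -> 'M[R]_(M, d)) (h : 'I_k -> R),
    S = [set x | forall i, dotmx (c i) x <= h i].

Definition affine_space (x0 : 'M[R]_(M, d)) W : set 'M[R]_(M, d) :=
  [set x | x - x0 \in W].

Definition affine_hull_of S (x0 : 'M[R]_(M, d)) W : Prop :=
  S `<=` affine_space x0 W /\
  forall x1 W1, S `<=` affine_space x1 W1 ->
    affine_space x0 W `<=` affine_space x1 W1.

(* The dimension of a set is that of its affine hull; it is -1 for set0. *)
Definition has_dim S (k : int) : Prop :=
  (S = set0 /\ k = -1) \/
  (S !=set0 /\ exists x0 W, affine_hull_of S x0 W /\ k = (\dim W)%:Z).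

(* The choices c = 0 with h = 0 and h = 1 yield the improper faces Pi, set0. *)
Definition face Pi F : Prop :=
  exists (c : 'M[R]_(M, d)) (h : R),
    (forall x, Pi x -> dotmx c x <= h) /\ F = Pi `&` [set x | dotmx c x = h].

Definition facet Pi F : Prop :=
  face Pi F /\ exists k : int, has_dim Pi k /\ has_dim F (k - 1).

(* A polyhedron has finitely many faces, so fset_set is meaningful here. *)
Definition nfacets Pi : nat := #|` fset_set [set F | facet Pi F]|.

End polytopes.

(* A sample delta : T stands for the vector (a delta, b delta). *)
Section scenario_game.
Context {disp : measure_display} {T : measurableType disp} {R : realType}.
Context {M d : nat}.
Variables (a : T -> 'M[R]_(M, d)) (b : T -> R) (Xm : 'I_M -> set 'rV[R]_d).
Implicit Types (x : 'M[R]_(M, d)) (y : 'rV[R]_d) (delta : T).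

Definition joint_set : set 'M[R]_(M, d) := [set x | forall m, Xm m (row m x)].

Definition constr x delta : R := dotmx (a delta) x - b delta.

Definition sample_set delta : set 'M[R]_(M, d) := [set x | constr x delta <= 0].

(* The joint decision (y, x^{-m}). *)
Definition deviate x (m : 'I_M) y : 'M[R]_(M, d) :=
  \matrix_(i, j) (if i == m then y 0 j else x i j).

Definition agent_sample_set (m : 'I_M) x delta : set 'rV[R]_d :=
  [set y | Xm m y /\ constr (deviate x m y) delta <= 0].

Definition feasible_set N (w : N.-tuple T) : set 'M[R]_(M, d) :=
  (\bigcap_(i in [set: 'I_N]) sample_set (tnth w i)) `&` joint_set.

Definition nash_equilibrium (J : 'I_M -> 'M[R]_(M, d) -> R) N (w : N.-tuple T)
    x : Prop :=
  feasible_set w x /\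
  forall (m : 'I_M) (y : 'rV[R]_d),
    (\bigcap_(i in [set: 'I_N]) agent_sample_set m x (tnth w i)) y ->
    J m x <= J m (deviate x m y).

Definition violation (P : probability T R) x : \bar R :=
  P [set delta | ~ sample_set delta x].

End scenario_game.

(* Main.v *)
(* If x in Pi_N has V(x) > epsilon(F_N), then F_N < N. Discarding redundant
   samples leaves at most F_N of them, each responsible for its own facet of
   Pi_N; since epsilon need not be monotone, they are completed arbitrarily
   to a set I of exactly F_N indices whose samples determine Pi_N. For a
   fixed I with k elements, V is lower semicontinuous and Pi_N is convex with
   interior points, so x may be replaced by the first rational point q of
   Pi_I with V(q) > epsilon(k). This q depends only on the samples in I, and
   the N - k others must all be satisfied at q, which has probability at most
   (1 - epsilon(k))^(N - k). Summing over I gives beta. *)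
Require Import Defs.
From HB Require Import structures.
From mathcomp Require Import all_boot all_order all_algebra lra.
From mathcomp Require Import all_classical all_reals all_analysis.

Set Implicit Arguments.
Unset Strict Implicit.
Unset Printing Implicit Defensive.

Import Order.TTheory GRing.Theory Num.Theory numFieldNormedType.Exports.

Local Open Scope classical_set_scope.
Local Open Scope ring_scope.

(* MathComp's unrelated dotmx shadows the one of Defs. *)
Local Notation dotmx := Defs.dotmx.

(** * Inner product of matrices and sufficiently small steps *)

Section dot_product.
Context {R : realType} {M d : nat}.
Implicit Types (c x v : 'M[R]_(M, d)) (S : set 'M[R]_(M, d)).

Lemma dotmx_is_linear c : scalar (dotmx c).
Proof.
move=> t x y; rewrite /dotmx mulr_sumr -big_split; apply: eq_bigr => m _ /=.
rewrite mulr_sumr -big_split; apply: eq_bigr => j _ /=.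
by rewrite !mxE mulrDr mulrCA.
Qed.

HB.instance Definition _ c :=
  GRing.isLinear.Build R 'M[R]_(M, d) R _ (dotmx c) (dotmx_is_linear c).

Lemma dotmxZ c t x : dotmx c (t *: x) = t * dotmx c x.
Proof. exact: linearZ. Qed.

Lemma dotmxD c x y : dotmx c (x + y) = dotmx c x + dotmx c y.
Proof. exact: linearD. Qed.

Lemma dotmxB c x y : dotmx c (x - y) = dotmx c x - dotmx c y.
Proof. exact: linearB. Qed.

Lemma dot0mx x : dotmx 0 x = 0.
Proof.
by rewrite /dotmx big1// => m _; rewrite big1// => j _; rewrite mxE mul0r.
Qed.

Lemma dotmx_gt0 c : c != 0 -> 0 < dotmx c c.
Proof.
have ge0 m : 0 <= \sum_j c m j * c m j.
  by apply: sumr_ge0 => j _; rewrite -expr2 sqr_ge0.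
move=> c0; rewrite lt_neqAle sumr_ge0 ?andbT// eq_sym.
apply: contra_neq c0 => /eqP; rewrite psumr_eq0// => /allP cc0.
apply/matrixP => m j; rewrite mxE; have := cc0 m (mem_index_enum _).
rewrite /= psumr_eq0 => [/allP/(_ j (mem_index_enum _))|i _].
  by rewrite /= mulf_eq0 orbb => /eqP.
by rewrite -expr2 sqr_ge0.
Qed.

Lemma dotmx_le c x (K : R) : (forall m j, `|x m j| <= K) ->
  `|dotmx c x| <= K * \sum_m \sum_j `|c m j|.
Proof.
move=> xK; apply: (le_trans (ler_norm_sum _ _ _)).
rewrite mulr_sumr; apply: ler_sum => m _.
apply: (le_trans (ler_norm_sum _ _ _)).
rewrite mulr_sumr; apply: ler_sum => j _.
by rewrite normrM mulrC ler_wpM2r.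
Qed.

Lemma interior_box S x : S° x ->
  exists2 e : R, 0 < e & forall v, (forall m j, `|v m j| < e) -> S (x + v).
Proof.
move=> /nbhs_ballP[e /= e0 sub]; exists e => // v ve; apply: sub.
by split=> // m j; rewrite /ball /= mxE opprD addNKr normrN.
Qed.

(** The reciprocal of 1 plus all ratios [|g i| / s i] is a step short enough for every index at
    once; the summand 1 keeps it well defined and the inequalities strict. *)
Lemma step_below_slacks (K : finType) (P : pred K) (s g : K -> R) :
  (forall i, P i -> 0 < s i) ->
  exists2 t : R, 0 < t & forall i, P i -> t * g i < s i.
Proof.
move=> s0; pose B := 1 + \sum_(i | P i) `|g i| / s i.
have sum0 : 0 <= \sum_(i | P i) `|g i| / s i.
  by apply: sumr_ge0 => i /s0 si; rewrite divr_ge0// ltW.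
have B0 : 0 < B by rewrite /B; lra.
exists B^-1; first by rewrite invr_gt0.
move=> i Pi; have si := s0 _ Pi.
rewrite mulrC ltr_pdivrMr// mulrC -ltr_pdivrMr//.
apply: (@le_lt_trans _ _ (`|g i| / s i)).
  by rewrite ler_wpM2r ?invr_ge0 ?(ltW si)// ler_norm.
rewrite /B (bigD1 i)//= addrCA ltrDl ltr_pwDl//.
by apply: sumr_ge0 => k /andP[/s0 sk _]; rewrite divr_ge0// ltW.
Qed.

Lemma small_multiple v (e : R) : 0 < e ->
  exists2 t : R, 0 < t & forall m j, `|(t *: v) m j| < e.
Proof.
move=> e0; have [t t0 tP] := @step_below_slacks ('I_M * 'I_d)%type xpredT
  (fun=> e) (fun p => `|v p.1 p.2|) (fun _ _ => e0).
by exists t => // m j; rewrite mxE normrM (gtr0_norm t0); exact: (tP (m, j)).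
Qed.

End dot_product.

(** * Polyhedra, their faces and nonredundant constraints *)

Section polyhedra.
Context {R : realType} {M d : nat} {K : finType}.
Variables (c : K -> 'M[R]_(M, d)) (h : K -> R).
Implicit Types (A B : {set K}) (x y z v : 'M[R]_(M, d)) (F : set 'M[R]_(M, d)).

(** The constraints are indexed by a fixed finite type and only [A] varies, so that discarding
    constraints amounts to shrinking [A]. *)
Definition halfspaces A : set 'M[R]_(M, d) :=
  [set x | forall i, i \in A -> dotmx (c i) x <= h i].

Lemma halfspacesS A B : A \subset B -> halfspaces B `<=` halfspaces A.
Proof. by move=> /fintype.subsetP AB x Bx i /AB/Bx. Qed.

Lemma halfspaces_convex A x y t : 0 <= t <= 1 ->
  halfspaces A x -> halfspaces A y -> halfspaces A (x + t *: (y - x)).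
Proof.
move=> /andP[t0 t1] Ax Ay i /[dup] /Ax xi /Ay yi.
rewrite dotmxD dotmxZ dotmxB /=.
move: (dotmx _ x) (dotmx _ y) xi yi => p q xi yi; nra.
Qed.

Lemma halfspaces_step A x v : halfspaces A x ->
  (forall i, i \in A -> dotmx (c i) x < h i \/ dotmx (c i) v <= 0) ->
  exists2 t : R, 0 < t & halfspaces A (x + t *: v).
Proof.
move=> Ax slack.
have [t t0 tP] := @step_below_slacks R K
  [pred i | dotmx (c i) x < h i] (fun i => h i - dotmx (c i) x)
  (fun i => dotmx (c i) v) ltac:(by move=> i /=; rewrite subr_gt0).
exists t => // i iA; rewrite dotmxD dotmxZ /= addrC -lerBrDr.
have [xi|vi] := slack i iA; first by rewrite ltW//; apply: tP.
by apply: (@le_trans _ _ 0); [rewrite pmulr_rle0|rewrite subr_ge0 Ax].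
Qed.

(** A small step from [z] along [c i] stays inside and strictly increases the form of [c i]. The
    case of a zero normal remains because [a delta] may vanish. *)
Lemma halfspaces_interior_lt A z i : (halfspaces A)° z -> i \in A ->
  dotmx (c i) z < h i \/ c i = 0.
Proof.
move=> /interior_box[e e0 ze] iA.
have [->|ci0] := eqVneq (c i) 0; [by right|left].
have [t t0 /ze /(_ i iA)] := small_multiple (c i) e0.
apply: lt_le_trans; rewrite dotmxD dotmxZ /= ltrDl mulr_gt0//.
exact: dotmx_gt0.
Qed.

(** The constraints are treated one by one: moving to the midpoint of [x] and a point [y] strict for
    [k] makes [k] strict, and constraints already strict at [x] stay so because [y] satisfies
    them. *)
Lemma relative_interior_point A F : F !=set0 -> F `<=` halfspaces A ->
  (forall x y, F x -> F y -> F (x + 2^-1 *: (y - x))) ->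
  exists2 x, F x & forall i, i \in A -> (exists2 y, F y & dotmx (c i) y < h i) ->
    dotmx (c i) x < h i.
Proof.
move=> [x0 Fx0] FA Fmid.
suff [x Fx xP] : exists2 x, F x & forall i, i \in enum A ->
    (exists2 y, F y & dotmx (c i) y < h i) -> dotmx (c i) x < h i.
  by exists x => // i iA; apply: xP; rewrite mem_enum.
have : {subset enum A <= A} by move=> i; rewrite mem_enum.
elim: (enum A) => [|k s IHs] sA; first by exists x0.
have [i iA|x Fx xP] := IHs; first by apply: sA; rewrite inE iA orbT.
have [[y Fy yk]|nk] := pselect (exists2 y, F y & dotmx (c k) y < h k); last first.
  by exists x => // i; rewrite inE => /orP[/eqP-> /nk|/xP].
exists (x + 2^-1 *: (y - x)) => [|i]; first exact: Fmid.
move=> /[dup] /sA /[dup] /(FA _ Fx) xi /(FA _ Fy) yi.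
rewrite inE dotmxD dotmxZ dotmxB /= => /orP[/eqP ik _|/xP /[apply]].
- move: yk xi; rewrite -ik; lra.
- by move: yi; lra.
Qed.

(* A nonempty face is cut out by the constraints active on all of it: from a
   relative interior point x of F, one can move slightly away from any such y. *)
Lemma face_active A F : face (halfspaces A) F -> F !=set0 ->
  F = halfspaces A `&` [set y | forall i, i \in A ->
        (forall x, F x -> dotmx (c i) x = h i) -> dotmx (c i) y = h i].
Proof.
move=> [c0 [h0 [le0 FE]]] Fn0; apply/seteqP; split=> [x Fx|y [Ay yact]].
  by split=> [|i iA]; [move: Fx; rewrite FE => -[] | exact].
have [|x y'|x Fx xP] := @relative_interior_point A F Fn0.
- by rewrite FE => x [].
- rewrite FE => -[/= Ax xh] [/= Ay' yh]; split.
    by apply: halfspaces_convex => //; lra.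
  by rewrite /= dotmxD dotmxZ dotmxB /= xh yh subrr mulr0 addr0.
have [Ax xh] : halfspaces A x /\ dotmx c0 x = h0 by move: Fx; rewrite FE => -[].
have [//|i iA|t t0 At] := @halfspaces_step A x (x - y).
  have [/(xP i iA)|nlt] := pselect (exists2 y', F y' & dotmx (c i) y' < h i).
    by left.
  right; rewrite dotmxB yact// ?subr_le0 ?Ax// => x' Fx'; apply/le_anti.
  move: (Fx'); rewrite {1}FE => -[Ax' _]; rewrite Ax'//= leNgt.
  by apply/negP => lt; apply: nlt; exists x'.
(* The form of [c0] equals [h0] at [x] and is at most [h0] at [x + t *: (x - y)], so on the opposite
   side, at [y], it is at least [h0]. *)
suff h0y : h0 <= dotmx c0 y.
  by rewrite FE; split=> //=; apply/le_anti; rewrite le0.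
have := le0 _ At; rewrite dotmxD dotmxZ dotmxB xh.
by rewrite gerDl pmulr_rle0// subr_le0.
Qed.

(** A nonempty face is recovered from its set of active constraints, and there are finitely many
    such sets. This makes [nfacets] a genuine count, since [fset_set] defaults to the empty set on
    infinite sets. *)
Lemma finite_faces A : finite_set [set F | face (halfspaces A) F].
Proof.
pose cut (J : {set K}) :=
  halfspaces A `&` [set y | forall i, i \in J -> dotmx (c i) y = h i].
apply: (@sub_finite_set _ _ (set0 |` [set cut J | J in [set: {set K}]])).
  move=> F /= faceF; have [->|/set0P Fn0] := eqVneq F set0; first by left.
  right; exists [set i in A | `[< forall x, F x -> dotmx (c i) x = h i >]] => //.
  rewrite [RHS](face_active faceF Fn0); congr (_ `&` _).
  apply/seteqP; split=> y /= yP i.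
    by move=> iA act; apply: yP; rewrite inE iA; apply/asboolP.
  by rewrite inE => /andP[iA /asboolP]; exact: yP.
by rewrite finite_setU; split; [exact: finite_set1|exact: finite_image].
Qed.

(* x is the point where the segment from the interior point z to y, which
   violates only the i-th constraint, leaves the polyhedron. *)
Lemma nonredundant_point A i z y : i \in A -> (halfspaces A)° z ->
  halfspaces (A :\ i) y -> h i < dotmx (c i) y ->
  exists x, [/\ halfspaces A x, dotmx (c i) x = h i &
    forall j, j \in A -> j != i -> dotmx (c j) x < h j \/ c j = 0].
Proof.
move=> iA zint Ay yi; have Az := interior_subset zint.
have zi : dotmx (c i) z < h i.
  have [//|ci0] := halfspaces_interior_lt zint iA.
  by move: (Az i iA) yi; rewrite ci0 !dot0mx; lra.
pose t := (h i - dotmx (c i) z) / (dotmx (c i) y - dotmx (c i) z).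
have D0 : 0 < dotmx (c i) y - dotmx (c i) z by lra.
have t0 : 0 <= t by rewrite divr_ge0 //; lra.
(* Since [t < 1], the slack that the other constraints have at [z] survives at the exit point. *)
have t1 : t < 1 by rewrite ltr_pdivrMr//; lra.
have xi : dotmx (c i) (z + t *: (y - z)) = h i.
  by rewrite dotmxD dotmxZ dotmxB divfK ?gt_eqF//; lra.
have xj j : j \in A -> j != i ->
    dotmx (c j) (z + t *: (y - z)) < h j \/ c j = 0.
  move=> jA ji; have [zj|] := halfspaces_interior_lt zint jA; last by right.
  have yj : dotmx (c j) y <= h j by apply: Ay; rewrite !inE ji.
  left; rewrite dotmxD dotmxZ dotmxB.
  by move: (dotmx _ z) (dotmx _ y) zj yj => p q zj yj; nra.
exists (z + t *: (y - z)); split=> // j jA.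
have [->|ji] := eqVneq j i; first by rewrite xi.
have [/ltW//|cj0] := xj _ jA ji.
by have := Az j jA; rewrite cj0 !dot0mx.
Qed.

End polyhedra.

(** * Dimension, facets and irredundant systems of constraints *)

Section facets.
Context {R : realType} {M d : nat}.
Implicit Types (c x v : 'M[R]_(M, d)) (W : {vspace 'M[R]_(M, d)}).
Implicit Types S : set 'M[R]_(M, d).

Definition dot_form c : 'M[R]_(M, d) -> R^o := dotmx c.

HB.instance Definition _ c :=
  GRing.isLinear.Build R 'M[R]_(M, d) R^o _ (dot_form c) (dotmx_is_linear c).

Definition orthogonal_space c : {vspace 'M[R]_(M, d)} :=
  lker (linfun (dot_form c)).

Lemma orthogonal_spaceE c v : (v \in orthogonal_space c) = (dotmx c v == 0).
Proof. by rewrite memv_ker lfunE. Qed.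

(** Rank-nullity: the image of the form is a subspace of a line, and it is nonzero because
    [dotmx c c] is positive. *)
Lemma dim_orthogonal_space c : c != 0 ->
  (\dim (orthogonal_space c)).+1 = \dim {:'M[R]_(M, d)}.
Proof.
move=> c0; have := limg_ker_dim (linfun (dot_form c)) fullv.
rewrite capfv => <-; rewrite -addn1; congr addn; apply/esym/eqP.
rewrite eqn_leq; apply/andP; split.
  by apply: (leq_trans (dimvS (subvf _))); rewrite dimvf.
rewrite lt0n dimv_eq0; apply/eqP => im0.
have := memv_img (linfun (dot_form c)) (memvf c).
rewrite im0 memv0 lfunE /= => /eqP cc0.
by have := dotmx_gt0 c0; rewrite [dotmx c c]cc0 ltxx.
Qed.

Lemma affine_space_direction x1 W x v (t : R) : 0 < t ->
  affine_space x1 W x -> affine_space x1 W (x + t *: v) -> v \in W.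
Proof.
rewrite /affine_space /= => t0 xW tv; have := rpredB tv xW.
rewrite opprB addrA subrK addrAC subrr add0r => /(rpredZ t^-1).
by rewrite scalerA mulVf ?scale1r// gt_eqF.
Qed.

(** An affine space containing [S] contains [x] and a further point in each direction of [W], so all
    of [W] lies in its direction space. *)
Lemma affine_hull_of_directions S x W : S x -> S `<=` affine_space x W ->
  (forall v, v \in W -> exists2 t : R, 0 < t & S (x + t *: v)) ->
  affine_hull_of S x W.
Proof.
move=> Sx SW dirW; split=> // x1 W1 SW1 y yW.
have [t t0 /SW1 St] := dirW _ yW.
have yxW1 := affine_space_direction t0 (SW1 _ Sx) St.
have := SW1 _ Sx; rewrite /affine_space /= => xW1.
by have := rpredD yxW1 xW1; rewrite addrA subrK.
Qed.

Lemma has_dim_interior S : S° !=set0 ->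
  has_dim S (\dim {:'M[R]_(M, d)})%:Z.
Proof.
move=> [x Sx]; right; split; first by exists x; exact: interior_subset.
exists x, fullv; split=> //; apply: affine_hull_of_directions.
- exact: interior_subset.
- by move=> y _; rewrite /affine_space /= memvf.
- move=> v _; have [e e0 xe] := interior_box Sx.
  by have [t t0 /xe] := small_multiple v e0; exists t.
Qed.

Context {K : finType}.
Variables (c : K -> 'M[R]_(M, d)) (h : K -> R).
Implicit Types (A B : {set K}).

Definition active A i := halfspaces c h A `&` [set x | dotmx (c i) x = h i].

(** All other constraints with nonzero normal are slack at [x], so from [x] one can move a little in
    every direction orthogonal to [c i] without leaving the face; these directions form a space of
    codimension 1. *)
Lemma facet_active A i x : (halfspaces c h A)° !=set0 ->
  i \in A -> c i != 0 -> halfspaces c h A x -> dotmx (c i) x = h i ->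
  (forall j, j \in A -> j != i -> dotmx (c j) x < h j \/ c j = 0) ->
  facet (halfspaces c h A) (active A i).
Proof.
move=> int iA ci0 Ax xi xj; split.
  by exists (c i), (h i); split=> // y /(_ i iA).
exists (\dim {:'M[R]_(M, d)})%:Z; split; first exact: has_dim_interior.
right; split; first by exists x.
exists x, (orthogonal_space (c i)); split; last first.
  by rewrite -(dim_orthogonal_space ci0) -addn1 PoszD addrK.
apply: affine_hull_of_directions => //.
  move=> y [_ /= yi].
  by rewrite /affine_space /= orthogonal_spaceE dotmxB yi xi subrr.
move=> v; rewrite orthogonal_spaceE => /eqP vi.
have [//|j jA|t t0 At] := @halfspaces_step _ _ _ _ c h A x v.
  have [->|/(xj j jA)[|->]] := eqVneq j i; [by right; rewrite vi|by left|].
  by right; rewrite dot0mx.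
by exists t => //; split=> //=; rewrite dotmxD dotmxZ vi mulr0 addr0.
Qed.

Lemma card_le_nfacets A B : (halfspaces c h A)° !=set0 ->
  (forall i, i \in B -> facet (halfspaces c h A) (active A i)) ->
  {in B &, injective (active A)} -> (#|B| <= nfacets (halfspaces c h A))%N.
Proof.
move=> int Bfacet inj.
have fin : finite_set [set F | facet (halfspaces c h A) F].
  by apply: sub_finite_set (finite_faces c h A) => F [].
rewrite cardE -(size_map (active A)); apply: uniq_leq_size.
  rewrite map_inj_in_uniq ?enum_uniq// => i j.
  by rewrite !mem_enum; exact: inj.
move=> F /mapP[i]; rewrite mem_enum => iB ->.
by rewrite in_fset_set// inE; exact: Bfacet.
Qed.

(** Take [B] minimal among the index sets containing [A0] that define the same polyhedron. Each [i]
    in [B] outside [A0] is nonredundant, hence the only tight constraint with nonzero normal at some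
    point, and so has a facet of its own. Constraints in [A0] are kept even when redundant, and are
    not counted. *)
Lemma irredundant_constraints A0 A : A0 \subset A ->
  (halfspaces c h A)° !=set0 ->
  exists B, [/\ A0 \subset B, B \subset A, halfspaces c h B = halfspaces c h A
    & (#|B :\: A0| <= nfacets (halfspaces c h A))%N].
Proof.
move=> A0A int.
pose good B := (A0 \subset B) && `[< halfspaces c h B = halfspaces c h A >].
have goodA : good A by rewrite /good A0A; apply/asboolP.
have [B /minsetP[/andP[A0B /asboolP BE] Bmin] BA] := minset_exists goodA.
exists B; split=> //; rewrite -BE in int *.
have point i : i \in B :\: A0 -> exists x, [/\ halfspaces c h B x,
    dotmx (c i) x = h i, c i != 0 &
    forall j, j \in B -> j != i -> dotmx (c j) x < h j \/ c j = 0].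
  rewrite inE => /andP[iA0 iB]; have [z zint] := int.
  have [y By nBy] : exists2 y, halfspaces c h (B :\ i) y & ~ halfspaces c h B y.
    apply: contrapT => nex.
    have sub : halfspaces c h (B :\ i) `<=` halfspaces c h B.
      by move=> y By; apply: contrapT => nBy; apply: nex; exists y.
    have /Bmin : good (B :\ i).
      rewrite /good; apply/andP; split; last first.
        apply/asboolP; rewrite -BE; apply/seteqP; split=> //.
        exact/halfspacesS/subsetDl.
      by rewrite subsetD1 A0B iA0.
    by rewrite subsetDl => /(_ isT)/setP/(_ i); rewrite !inE eqxx iB.
  have yi : h i < dotmx (c i) y.
    rewrite ltNge; apply/negP => yi; apply: nBy => j jB.
    by have [->//|ji] := eqVneq j i; apply: By; rewrite !inE ji.
  have [x [Bx xi xj]] := nonredundant_point iB zint By yi.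
  (* With a zero normal, constraint [i] would hold everywhere because it holds at [z], yet [y]
     violates it. *)
  exists x; split=> //; apply: contraTneq yi => ci0.
  by have Bz := interior_subset zint; have := Bz i iB; rewrite ci0 !dot0mx -leNgt.
apply: card_le_nfacets => // [i iB|i j iB jB].
  have [x [Bx xi ci0 xj]] := point i iB.
  by apply: (@facet_active _ _ x) => //; move: iB; rewrite inE => /andP[].
have [x [Bx xi _ xj]] := point i iB; have [_ [_ _ cj0 _]] := point j jB.
(* If the two facets coincided, constraint [j] would be tight at [x], where it is slack. *)
move=> Eij; apply/eqP; rewrite eq_sym; apply/negPn/negP => ji.
have [_ /= xhj] : active B j x by rewrite -Eij; split.
have jB' : j \in B by move: jB; rewrite inE => /andP[].
have [|/eqP] := xj j jB' ji; first by rewrite xhj ltxx.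
by rewrite (negbTE cj0).
Qed.

End facets.

(** * Independence of disjoint groups of coordinates *)

Section cylinders.
Context {disp : measure_display} {T : measurableType disp} {R : realType}.
Variables (P : probability T R) (N : nat).
Implicit Types (I : {set 'I_N}) (A B C : set T).

Definition cylinder I A : set (N.-tuple T) :=
  [set w | forall i, i \in I -> A (tnth w i)].

Lemma measurable_cylinder I A : measurable A -> measurable (cylinder I A).
Proof.
move=> mA; rewrite (_ : cylinder I A = \bigcap_(i in [set` I])
    ((fun w : N.-tuple T => tnth w i) @^-1` A)).
  apply: fin_bigcap_measurable => [|i _]; first exact: finite_finset.
  by rewrite -[X in measurable X]setTI; exact: (measurable_tnth i).
by apply/seteqP; split=> w /= wA i => [/= iI|iI]; exact: wA.
Qed.

Lemma cylinderI I A B : cylinder I (A `&` B) = cylinder I A `&` cylinder I B.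
Proof.
apply/seteqP; split=> w /= => [wAB|[wA wB] i iI]; last first.
  by split; [exact: wA|exact: wB].
by split=> i /wAB[].
Qed.

Let p A : R := fine (P A).

Let pE A : measurable A -> P A = (p A)%:E.
Proof. by move=> mA; rewrite fineK// fin_num_measure. Qed.

Lemma power_prob_cylinders I A B : measurable A -> measurable B ->
  power_prob P N (cylinder I A `&` cylinder (~: I) B) =
  (p A ^+ #|I| * p B ^+ (N - #|I|))%:E.
Proof.
move=> mA mB.
rewrite (_ : _ `&` _ =
    [set w | forall i, (if i \in I then A else B) (tnth w i)]); last first.
  apply/seteqP; split=> w /= => [[wA wB] i|wAB].
    by case: ifPn => [/wA//|iI]; apply: wB; rewrite inE.
  split=> i iI; have := wAB i; first by rewrite iI.
  by move: iI; rewrite inE => /negbTE ->.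
rewrite (power_prob_box P (A := fun i => if i \in I then A else B)) => [|i];
  last by case: ifP.
rewrite (eq_bigr (fun i => (if i \in I then p A else p B)%:E)); last first.
  by move=> i _; case: ifP => _; exact: pE.
rewrite prodEFin (bigID (mem I)) /=; congr (_ * _)%:E.
  rewrite (eq_bigr (fun=> p A)) => [|i ->//].
  by rewrite prodr_const.
rewrite (eq_bigr (fun=> p B)) => [|i /negbTE ->//].
have -> : (N - #|I|)%N = #|~: I| by rewrite [RHS]cardsCs finset.setCK card_ord.
by rewrite -prodr_const; apply: eq_bigl => i; rewrite inE.
Qed.

(* The cylinders over I are stable under intersection, so the product rule
   passes from them to their differences by inclusion-exclusion. *)
Lemma power_prob_cylinder_diff I A B (s : seq (set T)) :
  measurable A -> measurable B -> {in s, forall C, measurable C} ->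
  power_prob P N ((cylinder I A `\` \big[setU/set0]_(C <- s) cylinder I C)
                  `&` cylinder (~: I) B) =
  (power_prob P N (cylinder I A `\` \big[setU/set0]_(C <- s) cylinder I C)
   * (p B ^+ (N - #|I|))%:E)%E.
Proof.
move=> + mB; elim: s A => [|C s IHs] A mA ms.
  rewrite big_nil setD0 power_prob_cylinders//.
  have := power_prob_cylinders I mA measurableT.
  rewrite (_ : cylinder (~: I) setT = setT); last first.
    by apply/seteqP; split=> w.
  by rewrite setIT => ->; rewrite [p setT]/p probability_setT /= expr1n mulr1.
have mC : measurable C by apply: ms; rewrite mem_head.
have {}ms : {in s, forall C, measurable C}.
  by move=> D Ds; apply: ms; rewrite inE Ds orbT.
rewrite big_cons; set U := \big[setU/set0]_(D <- s) cylinder I D in IHs *.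
have mU : measurable U.
  rewrite /U big_seq; apply: big_rec => // D V Ds mV.
  by apply: measurableU => //; exact: measurable_cylinder (ms _ Ds).
have mCA D : measurable D -> measurable (cylinder I D `\` U).
  by move=> mD; apply: measurableD => //; exact: measurable_cylinder.
have mcC := measurable_cylinder I mC.
have mcB := measurable_cylinder (~: I) mB.
have mAU := mCA _ mA.
have DE : cylinder I A `\` (cylinder I C `|` U) =
    (cylinder I A `\` U) `\` cylinder I C.
  by rewrite setUC -setDDl.
(* The intersection is again a difference of the same shape, so the induction hypothesis, which is
   general in [A], covers both terms of the subtraction. *)
have IE : (cylinder I A `\` U) `&` cylinder I C = cylinder I (A `&` C) `\` U.
  by rewrite cylinderI setIDAC setIDA.
have diff V W : measurable V -> measurable W ->
    power_prob P N (V `\` W) = (power_prob P N V - power_prob P N (V `&` W))%E.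
  by move=> mV mW; rewrite measureD// -ge0_fin_numE// fin_num_measure.
set X := cylinder I A `\` U in DE IE mAU *.
set Y := cylinder I (A `&` C) `\` U in IE.
have mY : measurable Y by apply: mCA; exact: measurableI.
rewrite DE; transitivity (power_prob P N (X `&` cylinder (~: I) B) -
                          power_prob P N (Y `&` cylinder (~: I) B))%E.
  rewrite -IE setIDAC setIDA [X `&` _ `&` _]setIAC.
  by apply: diff => //; exact: measurableI.
rewrite IHs// IHs//; last exact: measurableI.
rewrite (diff X (cylinder I C))// [X `&` _]IE muleBl//.
by rewrite fin_num_adde_defr// fin_num_measure.
Qed.

(** The [n]-th set of [seqDU] says that [n] is the first index for which all coordinates in [I] lie
    in [C n]. It depends only on those coordinates, so the remaining ones contribute an independent
    factor of at most [q ^+ (N - #|I|)]; the first-hit events are disjoint, with total mass at most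
    1. *)
Lemma power_prob_first_cylinder I (C : nat -> set T) (q : R) : 0 <= q ->
  (forall n, measurable (C n)) -> (forall n, (P (C n) <= q%:E)%E) ->
  (power_prob P N (\bigcup_n (seqDU (fun m => cylinder I (C m)) n
                              `&` cylinder (~: I) (C n)))
   <= (q ^+ (N - #|I|))%:E)%E.
Proof.
move=> q0 mC Cq; set D := seqDU _.
have mF n : measurable (cylinder I (C n)) by exact: measurable_cylinder.
have mD n : measurable (D n) by exact: seqDU_measurable.
have mDC n : measurable (D n `&` cylinder (~: I) (C n)).
  by apply: measurableI => //; exact: measurable_cylinder.
have hit n : (power_prob P N (D n `&` cylinder (~: I) (C n)) <=
    (q ^+ (N - #|I|))%:E * power_prob P N (D n))%E.
  have -> : D n = cylinder I (C n) `\`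
      \big[setU/set0]_(A <- [seq C k | k <- iota 0 n]) cylinder I A.
    by rewrite /D /seqDU big_map -[n in iota 0 n]subn0 -/(index_iota 0 n) big_mkord.
  rewrite power_prob_cylinder_diff// => [|A /mapP[k _ ->]//].
  rewrite muleC lee_wpmul2r// lee_fin lerXn2r ?nnegrE ?fine_ge0//.
  by rewrite -lee_fin -pE.
apply: le_trans; first apply: generalized_Boole_inequality => //.
  exact: bigcup_measurable.
apply: le_trans; first by apply: lee_nneseries => // n _; exact: hit.
rewrite nneseriesZl//.
rewrite -[leRHS]mule1 lee_wpmul2l ?lee_fin ?exprn_ge0//.
rewrite -[leLHS](_ : power_prob P N (\bigcup_n D n) = _).
  by apply: probability_le1; exact: bigcup_measurable.
apply: measure_semi_bigcup => //; first exact: trivIset_seqDU.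
exact: bigcup_measurable.
Qed.

End cylinders.

(** * Rational points that retain a large probability of violation *)

Section violation_approximation.
Context {disp : measure_display} {T : measurableType disp} {R : realType}.
Context {M d : nat}.
Variables (P : probability T R) (a : T -> 'M[R]_(M, d)) (b : T -> R).
Implicit Types (S : set 'M[R]_(M, d)) (x y z v : 'M[R]_(M, d)).

Lemma rational_matrix_approx x (r : R) : 0 < r ->
  exists q : 'M[rat]_(M, d), forall m j, `|(map_mx ratr q - x) m j| < r.
Proof.
move=> r0; have near m j : exists q : rat, `|ratr q - x m j| < r.
  have [|q] := @rat_in_itvoo R (x m j - r) (x m j + r); first by lra.
  by rewrite in_itv /= => qx; exists q; rewrite ltr_distl.
have /choice[q qP] : forall p : 'I_M * 'I_d,
    exists q : rat, `|ratr q - x p.1 p.2| < r by move=> p; exact: near.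
by exists (\matrix_(m, j) q (m, j)) => m j; rewrite !mxE; exact: (qP (m, j)).
Qed.

(** Going from [x] a fraction [t] of the way to the interior point [z] makes room for a box of
    radius [t * e] inside [S], and this box contains a rational point. *)
Lemma rational_point_near S x z (e : R) (n : nat) :
  (forall y y' (t : R), 0 <= t <= 1 -> S y -> S y' -> S (y + t *: (y' - y))) ->
  S x -> 0 < e -> (forall v, (forall m j, `|v m j| < e) -> S (z + v)) ->
  exists2 q : 'M[rat]_(M, d), S (map_mx ratr q) & forall m j,
    `|(map_mx ratr q - x) m j| <= n.+1%:R^-1 * (\sum_p `|(z - x) p.1 p.2| + e).
Proof.
move=> Sconv Sx e0 zS; set t : R := n.+1%:R^-1.
have t0 : 0 < t by rewrite invr_gt0 ltr0Sn.
have t1 : t <= 1 by rewrite invf_le1 ?ltr0Sn// ler1n.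
have [q qP] := rational_matrix_approx (x + t *: (z - x)) (mulr_gt0 t0 e0).
pose w := map_mx ratr q - (x + t *: (z - x)).
(* This places [q] on the segment from [x] to a point of the box around [z], to which convexity
   applies. *)
have qE : map_mx ratr q = x + t *: (z + t^-1 *: w - x).
  rewrite addrAC scalerDr scalerA divff ?gt_eqF// scale1r addrA /w.
  by rewrite [RHS]addrC subrK.
exists q => [|m j].
  rewrite qE; apply: Sconv => //; first by rewrite ltW.
  apply: zS => m j; rewrite mxE normrM normfV (gtr0_norm t0) mulrC.
  by rewrite ltr_pdivrMr// mulrC; exact: qP.
have -> : map_mx ratr q - x = t *: (z - x) + w.
  by rewrite /w opprD [RHS]addrC -!addrA addNr addr0.
rewrite mulrDr mxE (le_trans (ler_normD _ _))// lerD//; last exact/ltW/qP.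
rewrite mxE normrM (gtr0_norm t0) ler_wpM2l ?(ltW t0)//.
by rewrite (bigD1 (m, j))//= lerDl sumr_ge0.
Qed.

(* A sample violated at x is also violated at y n for all large n. *)
Lemma violation_le_limit x (y : nat -> 'M[R]_(M, d)) (K e : R) :
  (forall x', measurable [set delta | ~ sample_set a b delta x']) ->
  (forall n m j, `|(y n - x) m j| <= n.+1%:R^-1 * K) ->
  (forall n, (violation a b P (y n) <= e%:E)%E) ->
  (violation a b P x <= e%:E)%E.
Proof.
move=> mV yx ye; pose D n := [set delta | ~ sample_set a b delta (y n)].
(* These events increase with [k], each has probability at most [e], and their union will contain
   the violation event at [x]. *)
pose F k := \bigcap_(n in [set n | (k <= n)%N]) D n.
have mF k : measurable (F k).
  by apply: bigcap_measurableType => n _; exact: mV.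
have mUF : measurable (\bigcup_k F k) by exact: bigcup_measurable.
have F_le k : (P (F k) <= e%:E)%E.
  apply: le_trans (ye k); apply: le_measure; rewrite ?inE//.
  by move=> delta /(_ k); apply; rewrite /= leqnn.
have Fnd : {homo F : k l / (k <= l)%N >-> (k <= l)%O}.
  move=> k l kl; apply/subsetPset => delta Fk n /= ln.
  by apply: Fk; exact: leq_trans ln.
have cvgF := nondecreasing_cvg_mu mF mUF Fnd (mu := P).
apply: (@le_trans _ _ (P (\bigcup_k F k))).
  apply: le_measure; rewrite ?inE//.
  move=> delta /= /negP; rewrite /sample_set /= /constr -ltNge => gap.
  set g := dotmx _ _ - _ in gap.
  pose C := `|K| * \sum_m \sum_j `|a delta m j|.
  have C0 : 0 <= C.
    by rewrite mulr_ge0//; apply: sumr_ge0 => m _; exact: sumr_ge0.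
  (* From this index on, replacing [x] by [y n] changes the constraint by at most [C / n.+1], which
     is less than the gap [g]. *)
  exists (Num.bound (C / g)) => // n /= kn.
  have Cn : n.+1%:R^-1 * C < g.
    rewrite mulrC ltr_pdivrMr ?ltr0Sn// mulrC -ltr_pdivrMr//.
    apply: (lt_le_trans (archi_boundP _)); first by rewrite divr_ge0// ltW.
    by rewrite ler_nat ltnW.
  apply/negP; rewrite /sample_set /= /constr -ltNge.
  have : `|dotmx (a delta) (y n - x)| <= n.+1%:R^-1 * C.
    rewrite /C mulrA; apply: dotmx_le => m j.
    by apply: (le_trans (yx n m j)); rewrite ler_wpM2l ?invr_ge0// ler_norm.
  rewrite dotmxB ler_norml => /andP[+ _]; move: Cn; rewrite /g.
  by move: (n.+1%:R^-1 * C) (dotmx _ x) (dotmx _ (y n)) => u v w; lra.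
rewrite -(cvg_lim _ cvgF)//; apply: lime_le.
  by apply/cvg_ex; eexists; exact: cvgF.
by apply: nearW => k; exact: F_le.
Qed.

(** Otherwise all rational points of [S] would have violation at most [e], and so would their limit
    [x]. Only countably many candidate points then have to be considered. *)
Lemma violation_rational_point S x (e : R) :
  (forall x', measurable [set delta | ~ sample_set a b delta x']) ->
  (forall y y' (t : R), 0 <= t <= 1 -> S y -> S y' -> S (y + t *: (y' - y))) ->
  S° !=set0 -> S x -> (e%:E < violation a b P x)%E ->
  exists2 q : 'M[rat]_(M, d), S (map_mx ratr q) &
    (e%:E < violation a b P (map_mx ratr q))%E.
Proof.
move=> mV Sconv [z /interior_box[r r0 zS]] Sx ex; apply: contrapT => nq.
have /choice[q qP] : forall n, exists q : 'M[rat]_(M, d),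
    S (map_mx ratr q) /\ forall m j, `|(map_mx ratr q - x) m j| <=
      n.+1%:R^-1 * (\sum_p `|(z - x) p.1 p.2| + r).
  by move=> n; have [q] := rational_point_near n Sconv Sx r0 zS; exists q.
move: ex; apply/negP; rewrite -leNgt.
apply: (violation_le_limit mV (fun n => (qP n).2)) => n.
rewrite leNgt; apply/negP => lt; apply: nq.
by exists (q n) => //; exact: (qP n).1.
Qed.

End violation_approximation.

(** * Index sets of prescribed size and finite union bounds *)

Lemma exists_superset_card (N k : nat) (I : {set 'I_N}) : (#|I| <= k <= N)%N ->
  exists2 I' : {set 'I_N}, I \subset I' & #|I'| = k.
Proof.
move=> /andP[/subnKC <-]; elim: (k - #|I|)%N => [|n IHn] kN.
  by exists I; rewrite ?addn0.
rewrite addnS in kN *; have [I' II' I'E] := IHn (ltnW kN).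
have [i iI'] : exists i, i \notin I'.
  apply/existsP; rewrite -negb_forall; apply: contraL kN => /forallP I'T.
  rewrite -leqNgt -I'E -[leqLHS]card_ord; apply/subset_leq_card.
  by apply/fintype.subsetP => i _; exact: I'T.
exists (i |: I'); first exact: (fintype.subset_trans II' (finset.subsetUr _ _)).
by rewrite cardsU1 iI' I'E.
Qed.

(** Measurability is proved along with the bound because subadditivity needs it for the partial
    unions. *)
Lemma measure_big_setU_le (disp : measure_display) (T : measurableType disp)
    (R : realType) (mu : {measure set T -> \bar R}) (K : finType) (P : pred K)
    (U : K -> set T) (u : K -> R) :
  (forall i, P i -> measurable (U i) /\ (mu (U i) <= (u i)%:E)%E) ->
  measurable (\big[setU/set0]_(i | P i) U i) /\
  (mu (\big[setU/set0]_(i | P i) U i) <= (\sum_(i | P i) u i)%:E)%E.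
Proof.
move=> UP; elim/big_ind2: _ => //; first by rewrite measure0.
move=> A r B s [mA Ar] [mB Bs]; split; first exact: measurableU.
apply: (le_trans (measureU2 mu mA mB)).
by rewrite EFinD leeD.
Qed.

(** * Supporting samples and the bound for a fixed index set *)

Section scenario.
Context {disp : measure_display} {T : measurableType disp} {R : realType}.
Context {M d : nat}.
Variables (P : probability T R) (a : T -> 'M[R]_(M, d)) (b : T -> R).
Variables (Xm : 'I_M -> set 'rV[R]_d) (N : nat).
Implicit Types (w : N.-tuple T) (I : {set 'I_N}) (x : 'M[R]_(M, d)).

(** The samples in [I] alone determine the feasible set; only the nontrivial inclusion is stated. *)
Definition supports w I : Prop := forall x, joint_set Xm x ->
  (forall i, i \in I -> sample_set a b (tnth w i) x) -> feasible_set a b Xm w x.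

Lemma supports_subset w I I' : I \subset I' -> supports w I -> supports w I'.
Proof.
by move=> /fintype.subsetP II' wI x Xx xI'; apply: wI => // i /II'/xI'.
Qed.

Lemma feasible_halfspaces k (c : 'I_k -> 'M[R]_(M, d)) (h : 'I_k -> R) w :
  joint_set Xm = [set x | forall i, dotmx (c i) x <= h i] ->
  feasible_set a b Xm w =
  halfspaces (fun j => match j with inl i => c i | inr i => a (tnth w i) end)
    (fun j => match j with inl i => h i | inr i => b (tnth w i) end)
    [set: 'I_k + 'I_N].
Proof.
rewrite /feasible_set => ->; apply/seteqP; split=> x /=.
  move=> [xw xX] [i|i] _; first exact: xX.
  by rewrite -subr_le0; exact: (xw i).
move=> xch; split=> i; last by apply: (xch (inl i)); rewrite inE.
by move=> _; rewrite /sample_set /= subr_le0; apply: (xch (inr i)); rewrite inE.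
Qed.

Lemma feasible_set_convex w x y (t : R) : polyhedron (joint_set Xm) ->
  0 <= t <= 1 -> feasible_set a b Xm w x -> feasible_set a b Xm w y ->
  feasible_set a b Xm w (x + t *: (y - x)).
Proof.
move=> [k [c [h XE]]]; rewrite (feasible_halfspaces w XE).
exact: halfspaces_convex.
Qed.

(** The constraints of the polytope [X] play the part of [A0], so that only samples are counted
    against facets. *)
Lemma support_card w : polyhedron (joint_set Xm) ->
  (feasible_set a b Xm w)° !=set0 ->
  exists2 I, supports w I & (#|I| <= nfacets (feasible_set a b Xm w))%N.
Proof.
move=> [k [c0 [h0 XE]]]; have := feasible_halfspaces w XE.
set c := fun j => _; set h := fun j => _ => FE; rewrite FE.
pose X0 : {set 'I_k + 'I_N} := [set j | if j is inl _ then true else false]%SET.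
move=> /(irredundant_constraints (finset.subsetT X0))[B [X0B _ BE cardB]].
exists [set i | inr i \in B]%SET.
  move=> x; rewrite XE FE -BE => xX xB [i|i] iB; first exact: xX.
  by rewrite -subr_le0; apply: xB; rewrite inE.
apply: leq_trans cardB; rewrite -(card_imset _ (@inr_inj 'I_k 'I_N)).
apply/subset_leq_card/fintype.subsetP => _ /imsetP[i + ->].
by rewrite !inE.
Qed.

(** The threshold [e] is frozen here, whereas in the theorem it varies with the number of facets. *)
Definition risky_supports e I : set (N.-tuple T) := [set w |
  supports w I /\
  exists2 x, feasible_set a b Xm w x & (e%:E < violation a b P x)%E].

(** The rational points [q n] of [X] with violation above [e] are enumerated independently of [w].
    The first one satisfying the samples in [I] is feasible by the support property, so the other
    samples satisfy it too. A measurable superset is produced since the event itself is not shown to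
    be measurable. *)
Lemma risky_supports_bound (e : R) I : polyhedron (joint_set Xm) ->
  (forall w, (feasible_set a b Xm w)° !=set0) ->
  (forall x, measurable [set delta | ~ sample_set a b delta x]) ->
  e <= 1 ->
  exists U, [/\ risky_supports e I `<=` U, measurable U &
    (power_prob P N U <= ((1 - e) ^+ (N - #|I|))%:E)%E].
Proof.
move=> XP int mV e1.
pose good (q : 'M[rat]_(M, d)) := joint_set Xm (map_mx ratr q) /\
  (e%:E < violation a b P (map_mx ratr q))%E.
have goodP w : risky_supports e I w -> exists2 q, good q &
    feasible_set a b Xm w (map_mx ratr q).
  move=> [_ [x xw ex]].
  have [|q qw eq] := violation_rational_point mV _ (int w) xw ex.
    by move=> y y' t; exact: feasible_set_convex.
  by exists q => //; split=> //; case: qw.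
have [[q0 good0]|nogood] := pselect (exists q, good q); last first.
  exists set0; split=> //; last by rewrite measure0 lee_fin exprn_ge0// subr_ge0.
  by move=> w /goodP[q ? _]; apply: nogood; exists q.
(* The default [q0] makes every term of the enumeration good, as the bound on each [P (C n)]
   requires. *)
pose q n := if unpickle n is Some q then if `[< good q >] then q else q0 else q0.
have goodq n : good (q n).
  by rewrite /q; case: unpickle => [q'|//]; case: asboolP.
have qE q' : good q' -> exists n, q n = q'.
  by move=> gq'; exists (choice.pickle q'); rewrite /q choice.pickleK asboolT.
pose C n := [set delta | sample_set a b delta (map_mx ratr (q n))].
have CE n : C n = ~` [set delta | ~ sample_set a b delta (map_mx ratr (q n))].
  by apply/seteqP; split=> delta /=; [move=> ? | exact: contrapT].
have mC n : measurable (C n) by rewrite CE; apply: measurableC.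
have PC n : (P (C n) <= (1 - e)%:E)%E.
  rewrite CE probability_setC// EFinB leeB// ltW//.
  exact: (goodq n).2.
have q1 : 0 <= 1 - e by rewrite subr_ge0.
exists (\bigcup_n (seqDU (fun m => cylinder I (C m)) n
                   `&` cylinder (~: I) (C n))); split.
- move=> w /[dup] -[wI _] /goodP[q' /qE[n <-] nw].
  have : (\bigcup_n cylinder I (C n)) w.
    by exists n => // i _; exact: nw.1.
  rewrite seqDU_bigcup_eq => -[k _ wk]; exists k => //; split=> // i _.
  have [+ _] : feasible_set a b Xm w (map_mx ratr (q k)); last exact.
  apply: wI; first exact: (goodq k).1.
  exact: (subset_seqDU wk).
- apply: bigcup_measurable => n _; apply: measurableI.
    by apply: seqDU_measurable => k; exact: measurable_cylinder.
  exact: measurable_cylinder.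
- exact: power_prob_first_cylinder.
Qed.

End scenario.

Theorem corollary7 (R : realType) (M d : nat) (hM : (0 < M)%N) (hd : (0 < d)%N)
    (disp : measure_display) (T : measurableType disp) (P : probability T R)
    (a : T -> 'M[R]_(M, d)) (b : T -> R)
    (Xm : 'I_M -> set 'rV[R]_d) (J : 'I_M -> 'M[R]_(M, d) -> R)
    (X_nonempty : joint_set Xm !=set0)
    (X_compact : compact (joint_set Xm))
    (X_polyhedron : polyhedron (joint_set Xm))
    (N : nat) (hN : (0 < N)%N)
    (feasible_interior :
       forall w : N.-tuple T, (feasible_set a b Xm w)° !=set0)
    (beta : R) (hbeta : 0 < beta < 1)
    (epsilon : nat -> R)
    (epsilon01 : forall k, (k <= N)%N -> 0 <= epsilon k <= 1)
    (epsilon_gtN : forall k, (N < k)%N -> epsilon k = 1)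
    (epsilon_N : epsilon N = 1)
    (epsilon_sum :
       \sum_(0 <= k < N) 'C(N, k)%:R * (1 - epsilon k) ^+ (N - k) = beta)
    (measurable_violation :
       forall x : 'M[R]_(M, d), measurable [set delta | ~ sample_set a b delta x])
    (measurable_event :
       measurable [set w : N.-tuple T | exists x : 'M[R]_(M, d),
         nash_equilibrium a b Xm J w x /\
         ((epsilon (nfacets (feasible_set a b Xm w)))%:E
            < violation a b P x)%E]) :
  (power_prob P N [set w : N.-tuple T | exists x : 'M[R]_(M, d),
     nash_equilibrium a b Xm J w x /\
     ((epsilon (nfacets (feasible_set a b Xm w)))%:E
        < violation a b P x)%E] <= beta%:E)%E.
Proof.
have eps1 k : (k < N)%N -> epsilon k <= 1 by move=> /ltnW/epsilon01/andP[].
(* Only index sets with fewer than [N] elements matter; the others receive the dummy value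
   [setT]. *)
have /choice[U UP] : forall I : {set 'I_N}, exists U, (#|I| < N)%N ->
    [/\ risky_supports P a b Xm (epsilon #|I|) I `<=` U, measurable U &
      (power_prob P N U <= ((1 - epsilon #|I|) ^+ (N - #|I|))%:E)%E].
  move=> I; have [IN|] := ltnP #|I| N; last by exists setT.
  have [U ?] := risky_supports_bound P I X_polyhedron feasible_interior
    measurable_violation (eps1 _ IN).
  by exists U.
pose V (k : 'I_N) := \big[setU/set0]_(I : {set 'I_N} | #|I| == k) U I.
have VP (k : 'I_N) : measurable (V k) /\ (power_prob P N (V k) <=
    (\sum_(I : {set 'I_N} | #|I| == k) (1 - epsilon k) ^+ (N - k))%:E)%E.
  apply: measure_big_setU_le => I /eqP Ik.
  by have [|_ mU] := UP I; rewrite Ik.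
have [mW Wle] := @measure_big_setU_le _ _ _ (power_prob P N) _ xpredT V _
  (fun k _ => VP k).
(* The binomial coefficient counts the index sets with [k] elements. *)
have -> : beta = \sum_(k < N)
    \sum_(I : {set 'I_N} | #|I| == k) (1 - epsilon k) ^+ (N - k).
  rewrite -epsilon_sum big_mkord; apply: eq_bigr => k _.
  rewrite sumr_const mulr_natl; congr (_ *+ _).
  have := card_draws 'I_N k; rewrite card_ord => <-.
  by apply: eq_card => I; rewrite !inE.
apply: (le_trans _ Wle); apply: le_measure; rewrite ?inE//.
move=> w [x [[xw _] ex]].
have [I wI Ik] := support_card X_polyhedron (feasible_interior w).
move: Ik ex; set k := nfacets _ => Ik ex.
(* For [k >= N] the threshold is 1, which no probability exceeds. *)
have kN : (k < N)%N.
  rewrite ltnNge; apply/negP => Nk; move: ex; apply/negP; rewrite -leNgt.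
  rewrite (_ : epsilon k = 1) ?probability_le1//.
  by move: Nk; rewrite leq_eqVlt => /predU1P[<-//|/epsilon_gtN].
(* The size must be exactly [k] so that the threshold attached to [I'] is [epsilon k]. *)
have [|I' II' I'k] := @exists_superset_card N k I; first by rewrite Ik ltnW.
rewrite (bigD1 (Ordinal kN))//=; left; rewrite /V (bigD1 I') ?I'k//=; left.
have I'N : (#|I'| < N)%N by rewrite I'k.
have [sub _ _] := UP I' I'N; apply: sub; rewrite I'k; split.
  exact: supports_subset II' wI.
by exists x.
Qed.
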